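(* Every semisimple element of $\mathfrak{sp}(4,\mathbb{C})$ is conjugate (under $Sp(4,\mathbb{C})$) to an element $T_{a,b}$ of $\mathfrak{t}$. A complete list of one-dimensional subalgebras of $\mathfrak{sp}(4,\mathbb{C})$ with semisimple generators, up to conjugacy in $Sp(4,\mathbb{C})$, is $$\langle T_{1,b}\rangle \sim \langle T_{1,b^{-1}}\rangle,\ b\neq 0,\pm 1;\qquad \langle T_{1,0}\rangle;\qquad \langle T_{1,1}\rangle .$$ If $a,b\in\mathbb{C}$ with $a,b\neq 0$ and $b\neq \pm a$, then the subalgebras $\langle T_{a,b}\rangle$, $\langle T_{a,0}\rangle$ and $\langle T_{a,a}\rangle$ are pairwise inequivalent; $\langle T_{a,0}\rangle=\langle T_{1,0}\rangle$; $\langle T_{a,a}\rangle=\langle T_{1,1}\rangle$, which is conjugate to $\langle T_{1,-1}\rangle$; and $\langle T_{a,b}\rangle$ is conjugate to $\langle T_{a',b'}\rangle$ if and only if $\{a,b\}=\{\lambda a',\lambda b'\}$ or $\{a,b\}=\{\lambda a',-\lambda b'\}$ for some $\lambda\in\mathbb{C}^{\times}$.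
   Context: Let $J=\begin{pmatrix}0&0&1&0\\0&0&0&1\\-1&0&0&0\\0&-1&0&0\end{pmatrix}$. $\mathfrak{sp}(4,\mathbb{C})$ is the Lie algebra of $4\times4$ complex matrices $X$ with $JX^tJ=X$, and $Sp(4,\mathbb{C})=\{g\in GL(4,\mathbb{C}) : gJg^t=J\}$, acting on $\mathfrak{sp}(4,\mathbb{C})$ by conjugation $X\mapsto gXg^{-1}$. Elements are semisimple (nilpotent) if they are so as matrices. For $a,b\in\mathbb{C}$, $T_{a,b}=\mathrm{diag}(a,b,-a,-b)$, and $\mathfrak{t}=\{T_{a,b}: a,b\in\mathbb{C}\}$ is the diagonal Cartan subalgebra. $\langle\,\cdot\,\rangle$ denotes the complex linear span. Two subalgebras are equivalent (conjugate), written $\sim$, if some $g\in Sp(4,\mathbb{C})$ conjugates one onto the other. A generator of a one-dimensional subalgebra is a nonzero element of it. *)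

(* Defs.v *)
From mathcomp Require Import all_boot all_order all_algebra.
From mathcomp Require Import complex.
From mathcomp Require Import classical_sets reals.

Set Implicit Arguments.
Unset Strict Implicit.
Unset Printing Implicit Defensive.

Import GRing.Theory.
Local Open Scope ring_scope.

Section Definitions.
Variable F : fieldType.

Definition J4 : 'M[F]_4 :=
  block_mx (0 : 'M_2) (1%:M : 'M_2) (- 1%:M : 'M_2) (0 : 'M_2).

Definition sp4 : {pred 'M[F]_4} := [pred X | J4 *m X^T *m J4 == X].

Definition Sp4 : {pred 'M[F]_4} :=
  [pred g | (g \in unitmx) && (g *m J4 *m g^T == J4)].

Definition lie_bracket (X Y : 'M[F]_4) : 'M[F]_4 := X *m Y - Y *m X.

Definition sp4_subalgebra (U : {vspace 'M[F]_4}) : Prop :=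
  (forall X, X \in U -> X \in sp4) /\
  (forall X Y, X \in U -> Y \in U -> lie_bracket X Y \in U).

(* The map X |-> g X g^-1, written so that its linearity is inferred. *)
Definition Ad (g : 'M[F]_4) : 'M[F]_4 -> 'M[F]_4 :=
  mulmxr (invmx g) \o mulmx g.

Definition Sp4_conj (X Y : 'M[F]_4) : Prop :=
  exists2 g, g \in Sp4 & Ad g X = Y.

Definition Sp4_equiv (U V : {vspace 'M[F]_4}) : Prop :=
  exists2 g, g \in Sp4 & (linfun (Ad g) @: U)%VS = V.

(* Intended for F algebraically closed, where a matrix is semisimple exactly
   when it is diagonalizable over F. *)
Definition semisimple (X : 'M[F]_4) : Prop := diagonalizable X.

Definition one_dim_semisimple (U : {vspace 'M[F]_4}) : Prop :=
  [/\ sp4_subalgebra U, \dim U = 1%N &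
      exists X, [/\ X \in U, X != 0 & semisimple X]].

Definition Tdiag (a b : F) : 'M[F]_4 :=
  diag_mx (\row_(i < 4) [:: a; b; - a; - b]`_i).

Definition Tline (a b : F) : {vspace 'M[F]_4} := <[Tdiag a b]>%VS.

End Definitions.

(* Main.v *)
(** Write J for the symplectic form on row vectors.  Eigenspaces of X in sp(4)
    for eigenvalues x and y are J-orthogonal unless x + y = 0.  Hence in an
    eigenbasis of a semisimple X, a vector p has a partner r with J(p, r) <> 0
    and opposite eigenvalue; projecting the other two basis vectors onto the
    J-complement of <p, r> only mixes equal eigenvalues, so it yields a
    symplectic eigenbasis, which conjugates X to some T_{a,b}.  Sign changes and
    the swap of a and b are realised in Sp(4), while tr X^2 = 2 (a^2 + b^2) and
    det X = a^2 b^2 determine the multiset {a^2, b^2}; so this multiset is a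
    complete invariant of T_{a,b}, and of its line up to scaling. *)

Require Import Defs.
From mathcomp Require Import all_boot all_order all_algebra.
From mathcomp Require Import complex.
From mathcomp Require Import classical_sets reals.
From mathcomp Require Import perm ring.

Import GRing.Theory.
Local Open Scope ring_scope.

(** * The symplectic form on row vectors *)

Section SymplecticForm.
Variable F : fieldType.
Implicit Types (u v w p q r s : 'rV[F]_4) (g h X Y P : 'M[F]_4) (a b c d : F).

Local Notation i0 := (@Ordinal 4 0 isT).
Local Notation i1 := (@Ordinal 4 1 isT).
Local Notation i2 := (@Ordinal 4 2 isT).
Local Notation i3 := (@Ordinal 4 3 isT).

Lemma ord4P (T : 'I_4 -> Prop) : T i0 -> T i1 -> T i2 -> T i3 -> forall i, T i.
Proof.
move=> T0 T1 T2 T3 [[|[|[|[|//]]]] lt_i4].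
- by rewrite (_ : Ordinal _ = i0) //; apply: val_inj.
- by rewrite (_ : Ordinal _ = i1) //; apply: val_inj.
- by rewrite (_ : Ordinal _ = i2) //; apply: val_inj.
- by rewrite (_ : Ordinal _ = i3) //; apply: val_inj.
Qed.

Lemma big_ord4 (f : 'I_4 -> F) : \sum_i f i = f i0 + f i1 + f i2 + f i3.
Proof.
rewrite !big_ord_recl big_ord0 addr0 !addrA.
by congr (f _ + f _ + f _ + f _); apply: val_inj.
Qed.

(** The additions are in [nat], so there is no wraparound modulo 4, and each entry computes once i
    and j are literal ordinals. *)
Lemma J4E (i j : 'I_4) :
  J4 F i j = ((val j == val i + 2)%N)%:R - ((val i == val j + 2)%N)%:R.
Proof.
rewrite /J4 mxE; case: splitP => k /= ->; rewrite !mxE;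
  case: splitP => l /= ->; rewrite !mxE; move: k l.
all: by case=> [[|[|//]] ?] [[|[|//]] ?] /=; rewrite ?subr0 ?sub0r ?oppr0.
Qed.

Definition sform u v : F := (u *m J4 F *m v^T) 0 0.

Lemma sformE u v : sform u v =
  u 0 i0 * v 0 i2 + u 0 i1 * v 0 i3 - u 0 i2 * v 0 i0 - u 0 i3 * v 0 i1.
Proof.
have uJ j : (u *m J4 F) 0 j = \sum_k u 0 k * J4 F k j by rewrite mxE.
by rewrite /sform mxE big_ord4 !uJ !big_ord4 !J4E !mxE /=; ring.
Qed.

(** Reads g J g^T as the Gram matrix of the rows of g, so that g lies in Sp(4) exactly when its rows
    form a symplectic basis. *)
Lemma sform_row g (i j : 'I_4) :
  sform (row i g) (row j g) = (g *m J4 F *m g^T) i j.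
Proof.
by rewrite /sform -row_mul tr_row colE mulmxA -colE -row_mul [LHS]mxE [LHS]mxE.
Qed.

Lemma sformC u v : sform u v = - sform v u.
Proof. by rewrite !sformE; ring. Qed.

Lemma sformvv u : sform u u = 0.
Proof. by rewrite !sformE; ring. Qed.

Lemma sformDl u v w : sform (u + v) w = sform u w + sform v w.
Proof. by rewrite !sformE !mxE; ring. Qed.

Lemma sformZl a u v : sform (a *: u) v = a * sform u v.
Proof. by rewrite !sformE !mxE; ring. Qed.

Lemma sformDr u v w : sform u (v + w) = sform u v + sform u w.
Proof. by rewrite !sformE !mxE; ring. Qed.

Lemma sformZr a u v : sform u (a *: v) = a * sform u v.
Proof. by rewrite !sformE !mxE; ring. Qed.

Definition sform_lin := (sformDl, sformDr, sformZl, sformZr).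

(** * The group Sp(4), conjugacy of elements and of lines *)

Lemma mulJ4J4 : J4 F *m J4 F = - 1%:M.
Proof.
apply: etrans (mulmx_block (0 : 'M[F]_2) 1%:M (- 1%:M) 0 0 1%:M (- 1%:M) 0) _.
rewrite !mulmx0 !mul0mx mulmx1 mulmxN mulmx1 !add0r !addr0.
symmetry; apply: etrans (congr1 -%R (scalar_mx_block 2 2 1)) _.
by rewrite opp_block_mx !oppr0.
Qed.

Lemma unitmx_J4 : J4 F \in unitmx.
Proof.
have /mulmx1_unit[] // : J4 F *m - J4 F = 1%:M.
by rewrite mulmxN mulJ4J4 opprK.
Qed.

(** Since J is invertible, g J g^T = J already makes the factor g invertible. *)
Lemma Sp4E g : (g \in @Sp4 F) = (g *m J4 F *m g^T == J4 F).
Proof.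
rewrite inE; case: eqP => [gJg|_]; rewrite ?andbF // andbT.
by have := unitmx_J4; rewrite -gJg !unitmx_mul -andbA => /andP[].
Qed.

Lemma Sp4_unit g : g \in @Sp4 F -> g \in unitmx.
Proof. by case/andP. Qed.

Lemma Sp4M g h : g \in @Sp4 F -> h \in @Sp4 F -> g *m h \in @Sp4 F.
Proof.
rewrite !Sp4E => /eqP gJ /eqP hJ.
by rewrite trmx_mul -!mulmxA (mulmxA h) (mulmxA (h *m _)) hJ mulmxA gJ.
Qed.

Lemma Sp4_conjP X Y :
  Sp4_conj X Y <-> exists2 g, g \in @Sp4 F & g *m X = Y *m g.
Proof.
split=> -[g gS gX]; exists g => //; have gu := Sp4_unit _ gS.
  by rewrite -gX /Ad /= mulmxKV.
by rewrite /Ad /= gX mulmxK.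
Qed.

Lemma Sp4_conj_refl X : Sp4_conj X X.
Proof.
apply/Sp4_conjP; exists 1%:M; last by rewrite mul1mx mulmx1.
by rewrite Sp4E trmx1 mulmx1 mul1mx.
Qed.

Lemma Sp4_conj_trans X Y Z :
  Sp4_conj X Y -> Sp4_conj Y Z -> Sp4_conj X Z.
Proof.
move=> /Sp4_conjP[g gS gX] /Sp4_conjP[h hS hY]; apply/Sp4_conjP.
by exists (h *m g); rewrite ?Sp4M // -mulmxA gX mulmxA hY mulmxA.
Qed.

Lemma limg_Ad_line g X : (linfun (Ad g) @: <[X]> = <[Ad g X]>)%VS.
Proof. by rewrite limg_line lfunE. Qed.

Lemma Sp4_equiv_lineP X Y :
  Sp4_equiv <[X]>%VS <[Y]>%VS <-> exists2 l, l != 0 & Sp4_conj X (l *: Y).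
Proof.
split=> [[g gS] | [l l0 [g gS gX]]].
  rewrite limg_Ad_line => gXY.
  have /vlineP[k gX] : Ad g X \in <[Y]>%VS by rewrite -gXY memv_line.
  have [k0|k0] := eqVneq k 0; last by exists k => //; exists g.
  (* Here [Ad g X] is zero, hence so is Y, and any nonzero scalar serves. *)
  exists 1; rewrite ?oner_neq0 //; exists g => //.
  have /vlineP[m ->] : Y \in <[Ad g X]>%VS by rewrite gXY memv_line.
  by rewrite gX k0 !scale0r !scaler0.
exists g => //; rewrite limg_Ad_line gX.
apply/vspaceP => Z; apply/vlineP/vlineP => -[k ->].
  by exists (k * l); rewrite scalerA.
by exists (k / l); rewrite scalerA divfK.
Qed.

(** * Symplectic eigenbases of semisimple elements *)

Lemma sp4_skew X u v : X \in @sp4 F -> sform (u *m X) v = - sform u (v *m X).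
Proof.
move=> /eqP XJ; have {XJ}XJ : X *m J4 F = - (J4 F *m X^T).
  by rewrite -{1}XJ -mulmxA mulJ4J4 mulmxN mulmx1.
by rewrite /sform trmx_mul -!mulmxA (mulmxA X) XJ !mulmxA mulmxN mulNmx mxE !mulmxA.
Qed.

Lemma sp4_eigen_orth X u v a b : X \in @sp4 F ->
  u *m X = a *: u -> v *m X = b *: v -> sform u v != 0 -> a = - b.
Proof.
move=> Xsp uX vX uv; apply: (mulIf uv).
by have := sp4_skew _ u v Xsp; rewrite uX vX sformZl sformZr mulNr.
Qed.

(* The projection of q onto the J-orthogonal complement of the hyperbolic plane
   <p, r>; meaningful only when sform p r != 0. *)
Definition hyp_compl p r q : 'rV[F]_4 :=
  q + (- (sform q r / sform p r)) *: p + (sform q p / sform p r) *: r.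

Lemma hyp_compl_orth p r q : sform p r != 0 ->
  sform (hyp_compl p r q) p = 0 /\ sform (hyp_compl p r q) r = 0.
Proof.
move=> pr; rewrite !sform_lin !sformvv (sformC r p).
by split; field.
Qed.

(** A nonzero coefficient on p requires J(q, r) != 0, which forces b = -c = a; a nonzero coefficient
    on r likewise forces b = -a = c. Every correction term is thus a b-eigenvector. *)
Lemma hyp_compl_eigen X p r q a b c : X \in @sp4 F -> sform p r != 0 ->
  p *m X = a *: p -> r *m X = c *: r -> q *m X = b *: q ->
  hyp_compl p r q *m X = b *: hyp_compl p r q.
Proof.
move=> Xsp pr pX rX qX.
have ac := sp4_eigen_orth _ _ _ _ _ Xsp pX rX pr.
rewrite !mulmxDl -!scalemxAl pX qX rX !scalerDr !scalerA; congr (_ + _ *: _ + _ *: _).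
  have [->|qr] := eqVneq (sform q r) 0; first by rewrite mul0r oppr0 mul0r mulr0.
  by rewrite (sp4_eigen_orth _ _ _ _ _ Xsp qX rX qr) ac mulrC.
have [->|qp] := eqVneq (sform q p) 0; first by rewrite !mul0r mulr0.
by rewrite (sp4_eigen_orth _ _ _ _ _ Xsp qX pX qp) ac opprK mulrC.
Qed.

Lemma Sp4_conj_symplectic_basis X p q r s a b :
    sform p r = 1 -> sform q s = 1 -> sform p q = 0 -> sform p s = 0 ->
    sform q r = 0 -> sform r s = 0 ->
    p *m X = a *: p -> q *m X = b *: q ->
    r *m X = - a *: r -> s *m X = - b *: s ->
  Sp4_conj X (Tdiag a b).
Proof.
move=> pr qs pq ps qr rs pX qX rX sX; apply/Sp4_conjP.
(* With these rows, g X = T g is the four eigenvector equations, and g J g^T = J is the table of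
   pairings. *)
pose g := \matrix_(i < 4) [:: p; q; r; s]`_i.
exists g.
  rewrite Sp4E; apply/eqP/matrixP => i j.
  rewrite -sform_row !rowK J4E.
  elim/ord4P: i; elim/ord4P: j => /=;
    rewrite ?sformvv ?pr ?qs ?pq ?ps ?qr ?rs ?subr0 ?sub0r ?oppr0 //;
    by rewrite sformC ?pr ?qs ?pq ?ps ?qr ?rs ?oppr0.
apply/row_matrixP => i; rewrite !row_mul row_diag_mx -scalemxAl -rowE !rowK mxE.
by elim/ord4P: i.
Qed.

(** The eigenvalues c and d may be left free because nonzero pairings force c = -a and d = -b. The
    last two hypotheses carry what is needed from linear independence: the form is nondegenerate on
    the four vectors, and q projects to a nonzero vector. *)
Lemma sp4_diag_of_eigenbasis X p q r s a b c d : X \in @sp4 F ->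
    p *m X = a *: p -> q *m X = b *: q -> r *m X = c *: r -> s *m X = d *: s ->
    sform p r != 0 ->
    (forall u, sform u p = 0 -> sform u q = 0 -> sform u r = 0 ->
               sform u s = 0 -> u = 0) ->
    (forall x y, q + x *: p + y *: r != 0) ->
  Sp4_conj X (Tdiag a b).
Proof.
move=> Xsp pX qX rX sX pr nondeg indep.
have [qp0 qr0] := hyp_compl_orth p r q pr.
have [sp0 sr0] := hyp_compl_orth p r s pr.
have q'X := hyp_compl_eigen _ _ _ _ _ _ _ Xsp pr pX rX qX.
have s'X := hyp_compl_eigen _ _ _ _ _ _ _ Xsp pr pX rX sX.
have q'0 : hyp_compl p r q != 0 by apply: indep.
have qs0 : sform (hyp_compl p r q) (hyp_compl p r s) != 0.
  (* The projection of q is J-orthogonal to p and r, so it pairs with q and s as with their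
     projections; if those pairings vanish, it is orthogonal to the whole eigenbasis. *)
  apply: contraNneq q'0 => qs; apply/eqP/nondeg => //.
  - by have := sformvv (hyp_compl p r q);
      rewrite {2}/hyp_compl 2!sformDr !sformZr qp0 qr0 !mulr0 !addr0.
  - by move: qs; rewrite {2}/hyp_compl 2!sformDr !sformZr qp0 qr0 !mulr0 !addr0.
move: (hyp_compl p r q) (hyp_compl p r s) => q' s' in qp0 qr0 sp0 sr0 q'X s'X q'0 qs0.
have ac := sp4_eigen_orth _ _ _ _ _ Xsp pX rX pr.
have bd := sp4_eigen_orth _ _ _ _ _ Xsp q'X s'X qs0.
(* Rescaling one vector of each hyperbolic pair normalises both pairings to 1. *)
apply: (@Sp4_conj_symplectic_basis _ ((sform p r)^-1 *: p)
  ((sform q' s')^-1 *: q') r s').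
- by rewrite sformZl mulVf.
- by rewrite sformZl mulVf.
- by rewrite sformZl sformZr (sformC p q') qp0 oppr0 !mulr0.
- by rewrite sformZl (sformC p s') sp0 oppr0 mulr0.
- by rewrite sformZl qr0 mulr0.
- by rewrite sformC sr0 oppr0.
- by rewrite -scalemxAl pX !scalerA mulrC.
- by rewrite -scalemxAl q'X !scalerA mulrC.
- by rewrite ac opprK.
- by rewrite bd opprK.
Qed.

Lemma unitmx_mul_eq0 u P : P \in unitmx -> u *m P = 0 -> u = 0.
Proof. by move=> Pu uP; rewrite -(mulmxK Pu u) uP mul0mx. Qed.

Lemma sp4_semisimple_conj X : X \in @sp4 F -> semisimple X ->
  exists a b, Sp4_conj X (Tdiag a b).
Proof.
move=> Xsp [P Pu /diagonalizable_forPex[D /(simmxP Pu) PX]].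
(* The Gram matrix P J P^T is invertible, so its first row is not zero. *)
have [j Aj0] : exists j, sform (row i0 P) (row j P) != 0.
  apply/existsP; apply/contraT; rewrite negb_exists => /forallP A0.
  have Au : P *m J4 F *m P^T \in unitmx.
    by rewrite !unitmx_mul unitmx_tr Pu unitmx_J4.
  suff /rowP/(_ i0)/eqP : delta_mx 0 i0 = 0 :> 'rV[F]_4.
    by rewrite !mxE eqxx oner_eq0.
  apply: unitmx_mul_eq0 Au _; rewrite -rowE; apply/rowP => j.
  by rewrite mxE -sform_row mxE; apply/eqP; rewrite -[_ == _]negbK A0.
have [d eig] : exists d : 'I_4 -> F, forall i, row i P *m X = d i *: row i P.
  exists (D 0) => i.
  by rewrite -row_mul PX row_mul row_diag_mx -scalemxAl -rowE.
(* A transposition of rows moves the partner to index 2. It fixes row 0, since j is not 0: the form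
   is alternating. *)
wlog j2 : P d j Pu eig Aj0 {D PX} / j = i2.
  have rowP i : row i (row_perm (tperm j i2) P) = row (tperm j i2 i) P.
    by apply/rowP => k; rewrite !mxE.
  have j0 : j != i0 by apply: contraNneq Aj0 => ->; rewrite sformvv.
  move=> wl; apply: (wl (row_perm (tperm j i2) P) (d \o tperm j i2) i2) => //.
  - by rewrite row_permE unitmx_mul unitmx_perm.
  - by move=> i; rewrite rowP eig.
  - by rewrite !rowP tpermR tpermD.
move: Aj0; rewrite j2 => A02.
exists (d i0), (d i1).
apply: (sp4_diag_of_eigenbasis X (row i0 P) (row i1 P) (row i2 P) (row i3 P)) => //.
- move=> u u0 u1 u2 u3.
  apply: (unitmx_mul_eq0 _ (J4 F *m P^T)).
    by rewrite unitmx_mul unitmx_tr Pu unitmx_J4.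
  apply/rowP => k; rewrite mulmxA [RHS]mxE.
  have -> : (u *m J4 F *m P^T) 0 k = sform u (row k P).
    by rewrite /sform tr_row colE mulmxA -colE [RHS]mxE.
  by elim/ord4P: k.
move=> x y; apply/eqP.
rewrite !rowE !scalemxAl -!mulmxDl => /(unitmx_mul_eq0 _ _ Pu)/rowP/(_ i1)/eqP.
by rewrite !mxE /= !mulr0 !addr0 oner_eq0.
Qed.

(** * The diagonal elements T_{a,b} and their lines *)

Lemma Tdiag_mxE a b i j :
  Tdiag a b i j = [:: a; b; - a; - b]`_i *+ (i == j).
Proof. by rewrite !mxE. Qed.

Lemma scale_Tdiag l a b : l *: Tdiag a b = Tdiag (l * a) (l * b).
Proof.
apply/matrixP => i j; rewrite mxE !Tdiag_mxE mulrnAr; congr (_ *+ _).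
by elim/ord4P: i; rewrite //= mulrN.
Qed.

Lemma Tdiag_eq0 a b : (Tdiag a b == 0) = (a == 0) && (b == 0).
Proof.
apply/eqP/andP => [T0|[/eqP-> /eqP->]]; last first.
  by rewrite -[0 in LHS](mul0r 0) -scale_Tdiag scale0r.
by split; apply/eqP; [move/matrixP/(_ i0 i0): T0 | move/matrixP/(_ i1 i1): T0];
  rewrite !mxE eqxx.
Qed.

Lemma Tdiag_sp4 a b : Tdiag a b \in @sp4 F.
Proof.
have JT i j : (J4 F *m Tdiag a b) i j = J4 F i j * [:: a; b; - a; - b]`_j.
  by rewrite mul_mx_diag mxE; congr (_ * _); rewrite mxE.
rewrite inE tr_diag_mx; apply/eqP/matrixP => i j.
rewrite mxE big_ord4 !JT !J4E Tdiag_mxE.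
by elim/ord4P: i; elim/ord4P: j => /=; ring.
Qed.

Lemma diag_mx_diagonalizable n (d : 'rV[F]_n) : diagonalizable (diag_mx d).
Proof.
exists 1%:M; rewrite ?unitmx1 //; apply/diagonalizable_forPex; exists d.
by apply/(simmxP (unitmx1 _ _)); rewrite mul1mx mulmx1.
Qed.

Lemma Tline_one_dim_semisimple a b :
  (a != 0) || (b != 0) -> one_dim_semisimple (Tline a b).
Proof.
rewrite -negb_and -Tdiag_eq0 => T0; split.
- split=> [X /vlineP[k ->] | X Y /vlineP[k ->] /vlineP[l ->]].
    by rewrite scale_Tdiag Tdiag_sp4.
  rewrite /lie_bracket -!scalemxAl -!scalemxAr !scalerA (mulrC k) subrr.
  exact: mem0v.
- by rewrite dim_vline T0.
by exists (Tdiag a b); rewrite memv_line; split=> //; apply: diag_mx_diagonalizable.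
Qed.

(** * Weyl group moves on T_{a,b} *)

Let e (i : 'I_4) : 'rV[F]_4 := delta_mx 0 i.

Let e_form i j : sform (e i) (e j) = J4 F i j.
Proof. by rewrite -[e i]mulmx1 -[e j]mulmx1 -!rowE sform_row trmx1 mulmx1 mul1mx. Qed.

Let e_Tdiag i a b : e i *m Tdiag a b = [:: a; b; - a; - b]`_i *: e i.
Proof. by rewrite -rowE row_diag_mx mxE. Qed.

Lemma Sp4_conj_Tdiag_flip a b : Sp4_conj (Tdiag a b) (Tdiag a (- b)).
Proof.
(* Exchanging the vectors of the second hyperbolic pair negates b; the factor -1 keeps their pairing
   equal to 1. *)
apply: (Sp4_conj_symplectic_basis _ (e i0) (e i3) (e i2) (- 1 *: e i1)).
all: rewrite ?sformZr ?e_form ?J4E /= -?scalemxAl ?e_Tdiag ?opprK //.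
all: try by ring.
by rewrite !scalerA mulrC.
Qed.

Lemma Sp4_conj_Tdiag_swap a b : Sp4_conj (Tdiag a b) (Tdiag b a).
Proof.
apply: (Sp4_conj_symplectic_basis _ (e i1) (e i0) (e i3) (e i2)).
all: rewrite ?e_form ?J4E /= ?e_Tdiag ?opprK //.
all: by ring.
Qed.

Lemma Sp4_conj_Tdiag_sqr a b c d :
  a ^+ 2 = c ^+ 2 -> b ^+ 2 = d ^+ 2 -> Sp4_conj (Tdiag a b) (Tdiag c d).
Proof.
have flip2 (x y y' : F) : y ^+ 2 = y' ^+ 2 -> Sp4_conj (Tdiag x y) (Tdiag x y').
  move=> /eqP; rewrite eqf_sqr => /orP[] /eqP ->; first exact: Sp4_conj_refl.
  by have := Sp4_conj_Tdiag_flip x (- y'); rewrite opprK.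
(* Only the second entry can be flipped directly, so the first is flipped between two swaps. *)
move=> ac bd; apply: Sp4_conj_trans (flip2 _ _ _ bd) _.
apply: Sp4_conj_trans (Sp4_conj_Tdiag_swap _ _) _.
by apply: Sp4_conj_trans (flip2 _ _ _ ac) _; apply: Sp4_conj_Tdiag_swap.
Qed.

(** * Trace and determinant as conjugacy invariants *)

Lemma Sp4_conj_trace_sqr X Y : Sp4_conj X Y -> \tr (X *m X) = \tr (Y *m Y).
Proof.
move=> [g /Sp4_unit gu <-]; rewrite /Ad /= !mulmxA mulmxKV //.
by rewrite [RHS]mxtrace_mulC !mulmxA mulVmx // mul1mx.
Qed.

Lemma Sp4_conj_det X Y : Sp4_conj X Y -> \det X = \det Y.
Proof.
move=> /Sp4_conjP[g /Sp4_unit gu /(congr1 determinant)].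
rewrite !det_mulmx mulrC => /mulIf; apply.
by rewrite -unitfE -unitmxE.
Qed.

Lemma trace_Tdiag_sqr a b :
  \tr (Tdiag a b *m Tdiag a b) = 2 * (a ^+ 2 + b ^+ 2).
Proof. by rewrite mulmx_diag mxtrace_diag big_ord4 !mxE /=; ring. Qed.

Lemma det_Tdiag a b : \det (Tdiag a b) = a ^+ 2 * b ^+ 2.
Proof.
by rewrite det_diag !big_ord_recl big_ord0 !mxE /=; ring.
Qed.

Lemma Sp4_conj_TdiagP a b c d : (2 : F) != 0 ->
  Sp4_conj (Tdiag a b) (Tdiag c d) <->
  (a ^+ 2 = c ^+ 2 /\ b ^+ 2 = d ^+ 2) \/ (a ^+ 2 = d ^+ 2 /\ b ^+ 2 = c ^+ 2).
Proof.
move=> n2; split; last first.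
  case=> [[]|[ad bc]]; first exact: Sp4_conj_Tdiag_sqr.
  by apply: Sp4_conj_trans (Sp4_conj_Tdiag_swap _ _) _; apply: Sp4_conj_Tdiag_sqr.
move=> T; have := Sp4_conj_trace_sqr _ _ T; have := Sp4_conj_det _ _ T.
rewrite !det_Tdiag !trace_Tdiag_sqr => detE trE.
have sumE : a ^+ 2 + b ^+ 2 = c ^+ 2 + d ^+ 2.
  exact: (mulfI n2).
(* The two pairs of squares have the same sum and product, so a^2 is a root of (t - c^2)(t -
   d^2). *)
have /eqP : (a ^+ 2 - c ^+ 2) * (a ^+ 2 - d ^+ 2) = 0.
  transitivity (a ^+ 2 * (a ^+ 2 + b ^+ 2 - (c ^+ 2 + d ^+ 2))
                - (a ^+ 2 * b ^+ 2 - c ^+ 2 * d ^+ 2)); first by ring.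
  by rewrite sumE detE !subrr mulr0 subr0.
rewrite mulf_eq0 !subr_eq0 => /orP[] /eqP aE; [left|right]; split=> //;
  apply: (addrI (a ^+ 2)); rewrite sumE aE //.
by rewrite addrC.
Qed.

(** * Equivalence and classification of lines *)

Lemma Sp4_equiv_TlineP a b c d : (2 : F) != 0 ->
  Sp4_equiv (Tline a b) (Tline c d) <->
  exists2 l, l != 0 &
    (a ^+ 2 = (l * c) ^+ 2 /\ b ^+ 2 = (l * d) ^+ 2) \/
    (a ^+ 2 = (l * d) ^+ 2 /\ b ^+ 2 = (l * c) ^+ 2).
Proof.
move=> n2; rewrite Sp4_equiv_lineP; split=> -[l l0 T]; exists l => //.
  by move: T; rewrite scale_Tdiag; move/(Sp4_conj_TdiagP _ _ _ _ n2).
by rewrite scale_Tdiag; apply/Sp4_conj_TdiagP.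
Qed.

Lemma Tline_scale a b l : l != 0 -> Tline (l * a) (l * b) = Tline a b.
Proof.
move=> l0; rewrite /Tline -scale_Tdiag.
apply/vspaceP => X; apply/vlineP/vlineP => -[k ->].
  by exists (k * l); rewrite scalerA.
by exists (k / l); rewrite scalerA divfK.
Qed.

Lemma one_dim_semisimple_generator U : one_dim_semisimple U ->
  exists X a b, [/\ U = <[X]>%VS, Sp4_conj X (Tdiag a b) & (a != 0) || (b != 0)].
Proof.
move=> [[Usp _] dimU [X [XU X0 Xss]]].
have [a [b XT]] := sp4_semisimple_conj X (Usp X XU) Xss.
exists X, a, b; split=> //.
  apply/esym/eqP; rewrite eqEdim dim_vline X0 dimU leqnn andbT.
  by apply/subvP => Y /vlineP[k ->]; apply: memvZ.
(* A nonzero X cannot be conjugate to T_{0,0} = 0. *)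
rewrite -negb_and -Tdiag_eq0; apply: contraNneq X0 => T0.
move: XT; rewrite T0 => /Sp4_conjP[g /Sp4_unit gu]; rewrite mul0mx => gX.
by rewrite -(mulKmx gu X) gX mulmx0.
Qed.

Lemma one_dim_semisimple_classification U : one_dim_semisimple U ->
  [\/ exists b, [/\ b != 0, b != 1, b != -1 & Sp4_equiv U (Tline 1 b)],
      Sp4_equiv U (Tline 1 0) | Sp4_equiv U (Tline 1 1)].
Proof.
move=> /one_dim_semisimple_generator[X [a [b [-> XT ab0]]]].
have XTl l c d : l != 0 -> Sp4_conj (Tdiag a b) (Tdiag (l * c) (l * d)) ->
    Sp4_equiv <[X]>%VS (Tline c d).
  move=> l0 T; apply/Sp4_equiv_lineP; exists l => //.
  by rewrite scale_Tdiag; apply: Sp4_conj_trans XT T.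
(* If a = 0, a swap brings the nonzero b to the front; otherwise dividing by a leaves the ratio b /
   a, whose values 0, 1 and -1 are separated out. *)
have [a0|a0] := eqVneq a 0.
  rewrite a0 eqxx /= in ab0; apply: Or32; apply: (XTl b) => //.
  by rewrite mulr1 mulr0 a0; apply: Sp4_conj_Tdiag_swap.
have bE : b = a * (b / a) by rewrite mulrC divfK.
have [c0|c0] := eqVneq (b / a) 0.
  apply: Or32; apply: (XTl a) => //.
  by rewrite -c0 -bE mulr1; apply: Sp4_conj_refl.
have [c1|c1] := eqVneq (b / a) 1.
  apply: Or33; apply: (XTl a) => //.
  by rewrite -{2}c1 -bE mulr1; apply: Sp4_conj_refl.
have [cN1|cN1] := eqVneq (b / a) (-1).
  apply: Or33; apply: (XTl a) => //.
  (* Ratio -1 falls into the class of ratio 1, as only squares matter. *)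
  by apply: Sp4_conj_Tdiag_sqr; rewrite mulr1 // bE cN1 mulrN1 sqrrN.
apply: Or31; exists (b / a); split=> //; apply: (XTl a) => //.
by rewrite -bE mulr1; apply: Sp4_conj_refl.
Qed.

End SymplecticForm.

(** Two distinct elements lying in {x, y} must be x and y in some order. *)
Lemma set2_eqP (T : Type) (a b x y : T) : a <> b ->
  ([set a; b] = [set x; y])%classic <-> (a = x /\ b = y) \/ (a = y /\ b = x).
Proof.
move=> ab; split=> [E | [[-> ->] //|[-> ->]]]; last exact: setUC.
have : ([set x; y] a)%classic by rewrite -E; left.
have : ([set x; y] b)%classic by rewrite -E; right.
by case=> /= bE [] /= aE; [case: ab; rewrite aE | right | left | case: ab; rewrite aE].
Qed.

Theorem theorem4p1 (R : realType) :
  (forall X : 'M[R[i]]_4, X \in @sp4 R[i] -> semisimple X ->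
     exists a b : R[i], Sp4_conj X (Tdiag a b)) /\
  [/\ forall b : R[i], b != 0 -> b != 1 -> b != -1 ->
        one_dim_semisimple (Tline 1 b) /\
        Sp4_equiv (Tline 1 b) (Tline 1 b^-1),
      one_dim_semisimple (Tline (1 : R[i]) 0),
      one_dim_semisimple (Tline (1 : R[i]) 1) &
      forall U : {vspace 'M[R[i]]_4}, one_dim_semisimple U ->
        [\/ exists b : R[i], [/\ b != 0, b != 1, b != -1 &
                                 Sp4_equiv U (Tline 1 b)],
            Sp4_equiv U (Tline 1 0) |
            Sp4_equiv U (Tline 1 1)]] /\
  (forall a b : R[i], a != 0 -> b != 0 -> b != a -> b != - a ->
     [/\ ~ Sp4_equiv (Tline a b) (Tline a 0),
         ~ Sp4_equiv (Tline a b) (Tline a a) &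
         ~ Sp4_equiv (Tline a 0) (Tline a a)] /\
     [/\ Tline a 0 = Tline 1 0,
         Tline a a = Tline 1 1,
         Sp4_equiv (Tline (1 : R[i]) 1) (Tline 1 (-1)) &
         forall a' b' : R[i],
           Sp4_equiv (Tline a b) (Tline a' b') <->
           exists l : R[i], l != 0 /\
             ([set a; b] = [set (l * a')%R; (l * b')%R] \/
              [set a; b] = [set (l * a')%R; (- (l * b'))%R])%classic]).
Proof.
have n2 : (2 : R[i]) != 0 by rewrite Num.Theory.pnatr_eq0.
split; first exact: sp4_semisimple_conj.
split.
  split.
  - move=> b b0 _ _; split; first by apply: Tline_one_dim_semisimple; rewrite oner_neq0.
    (* Scaling (1, b^-1) by b gives (b, 1), the swap of (1, b). *)
    apply/(Sp4_equiv_TlineP _ _ _ _ _ n2); exists b => //; right.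
    by rewrite divff // mulr1.
  - by apply: Tline_one_dim_semisimple; rewrite oner_neq0.
  - by apply: Tline_one_dim_semisimple; rewrite oner_neq0.
  - exact: one_dim_semisimple_classification.
move=> a b a0 b0 ba bNa.
have sqr_ab : b ^+ 2 <> a ^+ 2.
  by move/eqP; rewrite eqf_sqr (negPf ba) (negPf bNa).
have sqr0 x : x != 0 -> x ^+ 2 <> 0 :> R[i] by move=> x0 /eqP; rewrite sqrf_eq0 (negPf x0).
split; split.
- move=> /(Sp4_equiv_TlineP _ _ _ _ _ n2)[l _]; rewrite mulr0 expr0n /=.
  by case=> -[]; [move=> _ /(sqr0 _ b0) | move=> /(sqr0 _ a0)].
- by move=> /(Sp4_equiv_TlineP _ _ _ _ _ n2)[l _] [] [aE bE]; apply: sqr_ab; rewrite aE bE.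
- move=> /(Sp4_equiv_TlineP _ _ _ _ _ n2)[l l0].
  have la0 := mulf_neq0 l0 a0.
  by case=> -[_ /esym]; rewrite expr0n /= => /(sqr0 _ la0).
- by rewrite -[in RHS](Tline_scale _ _ _ _ a0) mulr1 mulr0.
- by rewrite -[in RHS](Tline_scale _ _ _ _ a0) mulr1.
- by apply/(Sp4_equiv_TlineP _ _ _ _ _ n2); exists 1; rewrite ?oner_neq0 // !mul1r sqrrN; left.
move=> a' b'; have ab : a <> b by apply/eqP; rewrite eq_sym.
rewrite (Sp4_equiv_TlineP _ _ _ _ _ n2); split.
  (* Taking m = l or m = -l absorbs the sign of the first entry, so that a sign remains only on the
     second. *)
  have sqr_scale x y l : l != 0 -> x ^+ 2 = (l * a') ^+ 2 -> y ^+ 2 = (l * b') ^+ 2 ->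
      exists m, [/\ m != 0, x = m * a' & y = m * b' \/ y = - (m * b')].
    move=> l0 /eqP + /eqP; rewrite !eqf_sqr => /orP[] /eqP -> /orP[] /eqP ->.
    - by exists l; split=> //; left.
    - by exists l; split=> //; right.
    - by exists (- l); rewrite oppr_eq0 !mulNr opprK; split=> //; right.
    - by exists (- l); rewrite oppr_eq0 !mulNr; split=> //; left.
  case=> l l0 [] [].
    move=> /(sqr_scale _ _ _ l0) /[apply] -[m [m0 aE bE]]; exists m; split=> //.
    by rewrite !(set2_eqP _ _ _ _ _ ab); tauto.
  (* In the swapped case it is b that is matched with a'. *)
  move=> aE /(sqr_scale _ _ _ l0) /(_ aE) [m [m0 bE aE']]; exists m; split=> //.
  by rewrite !(set2_eqP _ _ _ _ _ ab); tauto.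
case=> l [l0 H]; exists l => //; move: H.
by rewrite !(set2_eqP _ _ _ _ _ ab) => -[] [] [-> ->]; rewrite ?sqrrN; tauto.
Qed.
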